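(* Let $\overline{p}=(p_i)_{i\geq 1}$ be a sequence in $]0,1]$. If $\prod_{i=1}^{+\infty}p_i=0$ and $\sum_{i=1}^{+\infty}p_i=+\infty$, then the Markov chain on $\mathbb{N}$ given by the stochastic Fibonacci adding machine associated to $\overline{p}$ is null recurrent.
   Context: $\mathbb{N}=\{0,1,2,\ldots\}$. Fibonacci numbers: $F_0=1$, $F_1=2$, $F_n=F_{n-1}+F_{n-2}$ for $n\geq 2$. Every $N\in\mathbb{N}$ has a unique Fibonacci expansion $N=\sum_{i\geq 0}\varepsilon_i(N)F_i$ with $\varepsilon_i(N)\in\{0,1\}$, finitely many nonzero digits, and no two consecutive digits both equal to $1$. $[x]$ denotes the integer part of $x$. Stochastic Fibonacci adding machine: let $\overline{p}=(p_i)_{i\geq 1}\subset\,]0,1]$. It is the Markov chain on $\mathbb{N}$ whose one-step transition from a state $N$ with digits $\varepsilon_i=\varepsilon_i(N)$ is as follows. Draw independent random variables $(e_i)_{i\geq 0}$ with $e_i=1$ with probability $p_{i+1}$ and $e_i=0$ with probability $1-p_{i+1}$ (drawn afresh at each step). Put $c_{-1}=1$. The new state is $N'=\sum_i\varepsilon'_iF_i$, where: (a) if $\varepsilon_0=0$, then for all $i\geq 0$: $\varepsilon'_{2i}=\left[\frac{\varepsilon_{2i}+e_ic_{i-1}}{e_i\varepsilon_{2i+1}c_{i-1}+1}\right]$, $\varepsilon'_{2i+1}=\left[\frac{\varepsilon_{2i+1}}{e_ic_{i-1}+1}\right]$, $c_i=e_ic_{i-1}\varepsilon_{2i+1}$;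 (b) if $\varepsilon_0=1$, then $\varepsilon'_0=\left[\frac{1}{e_0+1}\right]$, $c_0=e_0$, and for all $i\geq 1$: $\varepsilon'_{2i-1}=\left[\frac{\varepsilon_{2i-1}+e_ic_{i-1}}{e_i\varepsilon_{2i}c_{i-1}+1}\right]$, $\varepsilon'_{2i}=\left[\frac{\varepsilon_{2i}}{e_ic_{i-1}+1}\right]$, $c_i=e_ic_{i-1}\varepsilon_{2i}$. The chain is called null recurrent if every state is recurrent with infinite mean return time. *)

(* Defs.v *)
From HB Require Import structures.
From mathcomp Require Import all_boot all_order all_algebra finmap zify.
From mathcomp Require Import all_classical all_reals all_analysis.
Set Implicit Arguments.
Unset Strict Implicit.
Unset Printing Implicit Defensive.
Import Order.TTheory GRing.Theory Num.Theory.
Import numFieldNormedType.Exports.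
Local Open Scope classical_set_scope.

Section fibonacci_expansion.
Local Open Scope nat_scope.

Fixpoint fib (n : nat) : nat :=
  match n with
  | 0 => 1
  | m.+1 => match m with 0 => 2 | k.+1 => fib m + fib k end
  end.

(* [fibval x] is $\sum_{i \ge 0} x_i F_i$, for a digit sequence [x] of finite
   support (the finitely supported big operator is 0 on infinite supports). *)
Definition fibval (x : nat -> nat) : nat :=
  \big[addn/0]_(i \in [set: nat]) (x i * fib i).

Definition fib_expansion (N : nat) (x : nat -> nat) : Prop :=
  [/\ forall i, x i <= 1,
      finite_set [set i | x i <> 0],
      forall i, ~ (x i = 1 /\ x i.+1 = 1) &
      fibval x = N].

(* The Fibonacci expansion of [N]; existence and uniqueness are
   [fib_digitsP] and [fib_expansion_uniq]. *)
Definition fib_digits (N : nat) : nat -> nat :=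
  xget (fun=> 0) [set x | fib_expansion N x].

#[global] Arguments fib : simpl never.

Lemma fibSS n : fib n.+2 = fib n.+1 + fib n. Proof. by []. Qed.

Lemma fib_gt0 n : 0 < fib n.
Proof.
suff : 0 < fib n /\ 0 < fib n.+1 by case.
by elim: n => // n [IH1 IH2]; rewrite fibSS; lia.
Qed.

Lemma fib_leq n : fib n <= fib n.+1.
Proof. by case: n => // n; rewrite fibSS; lia. Qed.

Lemma fibvalE K x : (forall i, K <= i -> x i = 0) ->
  fibval x = \sum_(0 <= i < K) x i * fib i.
Proof.
move=> xK; rewrite /fibval.
rewrite (fsbigE (index_iota 0 K)) //.
- by apply: eq_bigl => i; rewrite in_setT.
- exact: iota_uniq.
- move=> i _; rewrite mem_index_iota leq0n /= -leqNgt => Ki.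
  by rewrite xK.
Qed.

Lemma finite_support_bound (x : nat -> nat) :
  finite_set [set i | x i <> 0] <-> exists K, forall i, K <= i -> x i = 0.
Proof.
split=> [fx|[K xK]].
- exists (\max_(i <- fset_set [set i | x i <> 0]) i).+1 => i iK.
  apply: contrapT => xi0.
  have : i \in fset_set [set i | x i <> 0] by rewrite in_fset_set // inE.
  move=> /(@leq_bigmax_seq _ _ xpredT id) => /(_ isT) /= h.
  by have := leq_ltn_trans h iK; rewrite ltnn.
- apply: (sub_finite_set _ (finite_II K)) => i /= xi0.
  by rewrite ltnNge; apply/negP => /xK.
Qed.

Lemma fibsum_lt K x : (forall i, x i <= 1) ->
  (forall i, ~ (x i = 1 /\ x i.+1 = 1)) ->
  \sum_(0 <= i < K) x i * fib i < fib K.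
Proof.
move=> x1 xx.
suff : \sum_(0 <= i < K) x i * fib i < fib K /\
       \sum_(0 <= i < K.+1) x i * fib i < fib K.+1 by case.
elim: K => [|K [IH1 IH2]].
  rewrite !big_nat_recr //= !big_geq //; have := x1 0.
  by rewrite /fib; lia.
split=> //; rewrite big_nat_recr //= fibSS.
have := x1 K.+1; case E: (x K.+1) => [|[|?]] // _; first lia.
have := x1 K; case E' : (x K) => [|[|?]] // _; last by case: (xx K).
by rewrite big_nat_recr //= E'; lia.
Qed.

Lemma fib_expansion_uniq N x y :
  fib_expansion N x -> fib_expansion N y -> x = y.
Proof.
case=> x1 /finite_support_bound[K xK] xx xN.
case=> y1 /finite_support_bound[L yL] yy yN.
pose M := maxn K L.
have xM i : M <= i -> x i = 0 by move=> h; apply: xK; rewrite /M in h; lia.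
have yM i : M <= i -> y i = 0 by move=> h; apply: yL; rewrite /M in h; lia.
have := xN; rewrite -yN (fibvalE xM) (fibvalE yM) => Exy.
suff xy i : i < M -> x i = y i.
  by apply: funext => i; case: (ltnP i M) => [/xy//|h]; rewrite xM ?yM.
elim: M Exy i {xM yM} => // M IH; rewrite !big_nat_recr //= => Exy i.
have := fibsum_lt M x1 xx; have := fibsum_lt M y1 yy => hy hx.
have EM : x M = y M by have := x1 M; have := y1 M; nia.
rewrite ltnS leq_eqVlt => /orP[/eqP -> //|]; apply: IH; rewrite EM in Exy; lia.
Qed.

Lemma fib_expansion_exists N : exists x, fib_expansion N x.
Proof.
pose Q K := forall N, N < fib K -> exists x, [/\ forall i, x i <= 1,
  forall i, K <= i -> x i = 0, forall i, ~ (x i = 1 /\ x i.+1 = 1) &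
  \sum_(0 <= i < K) x i * fib i = N].
have QQ K : Q K /\ Q K.+1.
  elim: K => [|K [IH1 IH2]].
    split=> {}N hN; rewrite /fib in hN.
      exists (fun=> 0); split=> // [i [] //|].
      by rewrite big_geq //; lia.
    exists (fun i => if i == 0 then N else 0); split=> [[|i]//|[|i]//|i [_ ]//|].
    by rewrite big_nat1 /= /fib; lia.
  split=> // {}N hN; case: (ltnP N (fib K.+1)) => hNK.
    have [x [x1 x0 xx xN]] := IH2 _ hNK; exists x; split=> // [i iK|].
      by apply: x0; lia.
    by rewrite big_nat_recr //= xN x0 //; lia.
  have [|x [x1 x0 xx xN]] := IH1 (N - fib K.+1).
    by rewrite fibSS in hN; lia.
  exists (fun i => if i == K.+1 then 1 else x i); split.
  - by move=> i; case: ifP.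
  - by move=> i iK; case: ifP => [/eqP|_]; [lia|apply: x0; lia].
  - move=> i; case: ifP => [/eqP ->|iK].
      by case: ifP => [/eqP|_ []]; [lia|rewrite x0//; lia].
    case: ifP => [/eqP [->]|_]; last exact: xx.
    by rewrite x0 //; case.
  - rewrite big_nat_recr //= eqxx big_nat_recr //= ltn_eqF // x0 //.
    rewrite (@eq_big_nat _ _ _ _ _ _ (fun i => x i * fib i)) ?xN; first lia.
    by move=> i iK; rewrite ltn_eqF //; lia.
have [] := QQ N => QN _.
have FN : N < fib N.
  elim: N {QN} => // n IH; case: n IH => // n IH.
  by have := fib_gt0 n; rewrite fibSS; lia.
have [x [x1 x0 xx xN]] := QN _ FN.
exists x; split=> //; first by apply/finite_support_bound; exists N.
by rewrite (fibvalE x0).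
Qed.

Lemma fib_digitsP N : fib_expansion N (fib_digits N).
Proof. by apply: xgetPex; exact: fib_expansion_exists. Qed.

End fibonacci_expansion.

Section adding_machine.
Local Open Scope nat_scope.
Implicit Types (x : nat -> nat) (e : nat -> bool).

(* Carries are shifted by one: [carry_even x e i] and [carry_odd x e i] are
   $c_{i-1}$ in the cases $\varepsilon_0 = 0$ and $\varepsilon_0 = 1$. *)
Fixpoint carry_even x e (i : nat) : nat :=
  match i with
  | 0 => 1
  | j.+1 => e j * carry_even x e j * x (2 * j).+1
  end.

Fixpoint carry_odd x e (i : nat) : nat :=
  match i with
  | 0 => 1
  | j.+1 => match j with
            | 0 => e 0
            | _ => e j * carry_odd x e j * x (2 * j)
            end
  end.

(* Since all quantities are natural numbers, the integer part $[a/b]$ is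
   the Euclidean quotient [a %/ b]. *)
Definition new_digits_even x e (k : nat) : nat :=
  let i := k./2 in
  let c := carry_even x e i in
  if odd k then x k %/ (e i * c + 1)
  else (x k + e i * c) %/ (e i * x k.+1 * c + 1).

(* Here [uphalf k] is the $i$ with $k = 2i - 1$ or $k = 2i$. *)
Definition new_digits_odd x e (k : nat) : nat :=
  if k == 0 then 1 %/ (e 0 + 1)
  else
    let i := uphalf k in
    let c := carry_odd x e i in
    if odd k then (x k + e i * c) %/ (e i * x k.+1 * c + 1)
    else x k %/ (e i * c + 1).

Definition new_digits x e : nat -> nat :=
  if x 0 == 0 then new_digits_even x e else new_digits_odd x e.

Definition fib_step e (N : nat) : nat := fibval (new_digits (fib_digits N) e).

Lemma finite_new_digits x e : finite_set [set i | x i <> 0] ->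
  finite_set [set i | new_digits x e i <> 0].
Proof.
move=> /finite_support_bound[K xK]; apply/finite_support_bound.
have c0 i : K <= i -> carry_even x e i.+1 = 0.
  by move=> Ki; rewrite /= xK ?muln0 //; lia.
have d0 i : K <= i -> 0 < i -> carry_odd x e i.+1 = 0.
  case: i => // i Ki _.
  have -> : carry_odd x e i.+2 = e i.+1 * carry_odd x e i.+1 * x (2 * i.+1).
    by [].
  by rewrite [x _]xK ?muln0 //; lia.
exists (2 * K + 4) => k kK; rewrite /new_digits; case: ifP => _.
  rewrite /new_digits_even xK ?(@xK k.+1); try lia.
  have -> : k./2 = (k./2).-1.+1 by lia.
  by rewrite c0 ?muln0 ?div0n ?if_same //; lia.
rewrite /new_digits_odd ifF; last lia.
rewrite xK ?(@xK k.+1); try lia.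
have -> : uphalf k = (uphalf k).-1.+1 by lia.
by rewrite d0 ?muln0 ?div0n ?if_same //; lia.
Qed.

End adding_machine.

Section null_recurrence.
Context {d : measure_display} {T : measurableType d} {R : realType}.
Variable P : probability T R.
Local Open Scope ereal_scope.

(* First return time to [a] of the process [X], equal to [+oo] if the process
   never returns to [a] (the infimum of the empty set is [+oo]). *)
Definition return_time (X : nat -> T -> nat) (a : nat) (w : T) : \bar R :=
  ereal_inf [set (n%:R)%:E | n in [set n : nat | (0 < n)%N /\ X n w = a]].

(* [X a] is the chain started at [a]. *)
Definition null_recurrent (X : nat -> nat -> T -> nat) : Prop :=
  forall a : nat,
    P [set w | return_time (X a) a w < +oo] = 1 /\
    \int[P]_w return_time (X a) a w = +oo.

Definition independent_RVs {I : choiceType} {d' : measure_display}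
    {T' : measurableType d'} (X : I -> {RV P >-> T'}) : Prop :=
  forall (J : {fset I}) (A : I -> set T'),
    (forall j, j \in J -> measurable (A j)) ->
    P (\bigcap_(j in [set` J]) (X j @^-1` A j)) =
    \prod_(j <- J) P (X j @^-1` A j).

(* [e n i] is the variable $e_i$ drawn at the [n]-th step. *)
Definition adding_machine_draws (p : nat -> R)
    (e : nat -> nat -> {RV P >-> bool}) : Prop :=
  (forall n i, P (e n i @^-1` [set true]) = (p i.+1)%:E) /\
  independent_RVs (fun ni : nat * nat => e ni.1 ni.2).

Fixpoint fib_chain (e : nat -> nat -> {RV P >-> bool}) (a n : nat) (w : T)
    : nat :=
  match n with
  | 0%N => a
  | m.+1 => fib_step (fun i => e m i w) (fib_chain e a m w)
  end.

End null_recurrence.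

(* Main.v *)
Require Import Defs.
From mathcomp Require Import all_boot all_order all_algebra finmap zify ring lra.
From mathcomp Require Import all_classical all_reals all_analysis measurable_realfun.
Set Implicit Arguments.
Unset Strict Implicit.
Unset Printing Implicit Defensive.
Import Order.TTheory GRing.Theory Num.Theory.
Import numFieldNormedType.Exports.

(** From a state [N] the machine can only erase an initial run of digits of
    [N] or move to [N + 1].  Let [k] be the number of leading blocks 01 of [N]
    (read from the digit 0 if that digit is 0, and with an extra 0 in front
    otherwise).  If [r <= k] is the index of the first failing draw, the first
    [r] blocks are erased; if the draws 0 to [k] all succeed, the new state is
    [N + 1] (lemma [fib_step_outcome]).

    Since the chain climbs by unit steps and falls inside the current digits,
    between two consecutive Fibonacci numbers it can leave upwards, to the next
    Fibonacci number, or downwards, and then only to 0.  Two functions on the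
    states make this quantitative, where [mean] is the one-step mean:
    - [escape], constant between consecutive Fibonacci numbers and equal to
      [1 / Q_m] from [F_m] on, where [Q_m] is the probability of reaching [F_m]
      from 0 before coming back to 0.  It satisfies [mean escape = escape]
      outside 0 ([mean_escape]), and tends to infinity because the product of
      the [p_i] vanishes.
    - [ascent_time], the mean time needed to climb from 0 to a state.  It is
      additive over the digits and satisfies
      [mean ascent_time = ascent_time + 1] ([mean_ascent_time]).

    Recurrence.  Let [v x] be the probability that the chain started at [x]
    avoids [a] forever, and 0 for [x = a].  Below [a], [v] is harmonic and
    vanishes at [a], hence is 0 by the maximum principle.  Above [a], the same
    principle bounds [v] by [escape / escape F_n] up to [F_n], for each [n].
    Hence [v = 0] ([survival_to0]).

    Infinite mean.  If the mean return time to [a] were finite, the mean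
    hitting times of [a] from all larger states would be finite as well.  But
    the function [c (escape - E) - ascent_time], cut off at the zero [F_m] that
    a suitable [c] gives it, is a bounded subsolution of the equation of the
    mean hitting time of [a], so it bounds that time from below; and [c], which
    is at least [Q_m] times the mean time from 0 to [F_m], grows with [m] like
    the partial sums of the [p_i] ([reach_prob_level_time_ge],
    [truncated_time_unbounded]).

    The passage from the draws to these means is [avoid_prob]: the event of
    avoiding [a] during [n] steps splits into cylinders, whose probabilities
    independence turns into products. *)

Local Open Scope classical_set_scope.

(** * One step of the machine in terms of digits *)

Section step_structure.
Local Open Scope nat_scope.
Implicit Types (x z : nat -> nat) (e : nat -> bool).

Definition set_one x i : nat -> nat := fun j => if j == i then 1 else x j.

(** The expansion of [N] is that of [M] with the digit [i] switched on.  The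
    states reachable in one step from a given one are linked by this relation,
    and every function of the digits used below changes simply along it. *)
Definition adds_digit M i N : Prop :=
  fib_digits M i = 0 /\ fib_digits N = set_one (fib_digits M) i.

Lemma fib_digits_fibval x N : fib_expansion N x -> fib_digits N = x.
Proof. exact: (fib_expansion_uniq (fib_digitsP N)). Qed.

Lemma fib_digits_le1 N i : fib_digits N i <= 1.
Proof. by case: (fib_digitsP N). Qed.

Lemma fibval_digits N : fibval (fib_digits N) = N.
Proof. by case: (fib_digitsP N). Qed.

Lemma fib_digits_far N i : N < fib i -> fib_digits N i = 0.
Proof.
move=> Ni; have [x1 /finite_support_bound[K xK] _ xN] := fib_digitsP N.
case: (ltnP i K) => [iK|/xK //]; move: xN.
rewrite (fibvalE xK) (big_cat_nat _ (n := i)) //=; last exact: ltnW.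
rewrite [X in _ + X]big_ltn //=; have := x1 i.
by case: (fib_digits N i) => [//|[|//]] _; rewrite mul1n; lia.
Qed.

Lemma ltn_fib n : n < fib n.
Proof.
elim: n => // n IH; case: n IH => // n IH.
by have := fib_gt0 n; rewrite fibSS; lia.
Qed.

Lemma fib_homo i j : i <= j -> fib i <= fib j.
Proof.
move=> ij; rewrite -(subnK ij); elim: (j - i) => // n IH.
exact: leq_trans IH (fib_leq _).
Qed.

Lemma fib_digits_large N i : N <= i -> fib_digits N i = 0.
Proof.
move=> Ni; apply: fib_digits_far; apply: leq_trans (ltn_fib N) _.
exact: fib_homo.
Qed.

Lemma fibval_set_one x i : finite_set [set j | x j <> 0] -> x i = 0 ->
  fibval (set_one x i) = fibval x + fib i.
Proof.
move=> /finite_support_bound[K xK] xi.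
have xM j : K + i.+1 <= j -> x j = 0 by move=> ?; apply: xK; lia.
have yM j : K + i.+1 <= j -> set_one x i j = 0.
  by move=> ?; rewrite /set_one ifF ?xM //; lia.
rewrite (fibvalE xM) (fibvalE yM) !big_mkord.
have iM : i < K + i.+1 by lia.
rewrite (bigD1 (Ordinal iM)) //= [in RHS](bigD1 (Ordinal iM)) //=.
rewrite {1}/set_one eqxx xi mul0n mul1n add0n addnC; congr (_ + _).
apply: eq_bigr => -[j jM]; rewrite -val_eqE /= /set_one => /negbTE -> //.
Qed.

Lemma fib_expansion_sub x z N : fib_expansion N x -> (forall i, z i <= x i) ->
  fib_expansion (fibval z) z.
Proof.
case=> x1 /finite_support_bound[K xK] xx _ zx; split=> //.
- by move=> i; apply: leq_trans (zx i) _.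
- apply/finite_support_bound; exists K => i /xK xi.
  by have := zx i; rewrite xi leqn0 => /eqP.
- move=> i [zi zi1]; apply: (xx i).
  by have := zx i; have := zx i.+1; have := x1 i; have := x1 i.+1; lia.
Qed.

Lemma fib_expansion_set_one x N i : fib_expansion N x ->
  x i.-1 = 0 -> x i = 0 -> x i.+1 = 0 ->
  fib_expansion (N + fib i) (set_one x i).
Proof.
case=> x1 fx xx xN xp xi xs; split.
- by move=> j; rewrite /set_one; case: ifP.
- have /finite_support_bound[K xK] := fx.
  apply/finite_support_bound; exists (K + i.+1) => j Kj.
  by rewrite /set_one ifF ?xK //; lia.
- move=> j; rewrite /set_one; case: eqP => [->|ji].
    by rewrite ifF ?xs; [case|lia].
  case: eqP => [ij|_]; last exact: xx.
  by move: xp; rewrite -ij /= => ->; case.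
- by rewrite fibval_set_one // xN.
Qed.

Lemma adds_digitP M i N : fib_expansion N (set_one (fib_digits M) i) ->
  fib_digits M i = 0 -> adds_digit M i N.
Proof. by move=> h hi; split=> //; exact: fib_digits_fibval. Qed.

Lemma adds_digit_fib M i N : adds_digit M i N -> N = M + fib i.
Proof.
case=> h0 h; rewrite -[LHS]fibval_digits h fibval_set_one ?fibval_digits //.
by case: (fib_digitsP M).
Qed.

(** The two cases of the machine differ by a shift of the digits: when the
    digit 0 is 1, putting a 0 in front of the expansion brings back the other
    case.  The offset is the length of this padding. *)
Definition offset N : nat := fib_digits N 0.

Lemma offset_le1 N : offset N <= 1. Proof. exact: fib_digits_le1. Qed.

Lemma block_end_exists N : exists k, fib_digits N (k.*2.+1 - offset N) == 0.
Proof.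
by exists N; rewrite fib_digits_large //; have := offset_le1 N; lia.
Qed.

(** Number of leading blocks 01, where block [i] has its 1 at position
    [2 i + 1 - offset N]. *)
Definition blocks N : nat := ex_minn (block_end_exists N).

(** Clears the 1 of each of the first [r] blocks, for padding [o]. *)
Definition erase o r x : nat -> nat :=
  fun j => if odd (j + o) && (j + o < r.*2) then 0 else x j.

Definition erased N r : nat := fibval (erase (offset N) r (fib_digits N)).

Lemma block_end N : fib_digits N ((blocks N).*2.+1 - offset N) = 0.
Proof. by rewrite /blocks; case: ex_minnP => k /eqP. Qed.

Lemma in_block N i : i < blocks N -> fib_digits N (i.*2.+1 - offset N) = 1.
Proof.
rewrite /blocks; case: ex_minnP => k _ kmin ik.
have := fib_digits_le1 N (i.*2.+1 - offset N).
have : fib_digits N (i.*2.+1 - offset N) != 0.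
  by apply: contraTN ik => /kmin; rewrite -leqNgt.
by lia.
Qed.

Lemma even_digit N i : i <= blocks N -> fib_digits N (i.*2 - offset N) = 0 \/
  (i = 0 /\ offset N = 1).
Proof.
have [x1 _ xx _] := fib_digitsP N; have s1 := offset_le1 N.
case: i => [_|i ik].
  case E : (offset N) s1 => [|[|?]] // _; [left|by right].
  by rewrite -[RHS]E.
left; have := xx (i.*2.+1 - offset N); rewrite in_block //.
have -> : (i.*2.+1 - offset N).+1 = i.+1.*2 - offset N by lia.
by have := x1 (i.+1.*2 - offset N); lia.
Qed.

Lemma blocks_gt0 N : offset N = 1 -> 0 < blocks N.
Proof.
move=> s1; rewrite lt0n; apply/eqP => k0; have := block_end N.
by rewrite k0 s1 /= -/(offset N) s1.
Qed.

Lemma erase_le o r x i : erase o r x i <= x i.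
Proof. by rewrite /erase; case: ifP. Qed.

Lemma erasedP N r :
  fib_expansion (erased N r) (erase (offset N) r (fib_digits N)).
Proof. exact: fib_expansion_sub (fib_digitsP N) (erase_le _ _ _). Qed.

Lemma erased_digits N r :
  fib_digits (erased N r) = erase (offset N) r (fib_digits N).
Proof. exact: fib_digits_fibval (erasedP N r). Qed.

Lemma erased0 N : erased N 0 = N.
Proof.
rewrite /erased -[RHS]fibval_digits; congr fibval; apply: funext => j.
by rewrite /erase ltn0 andbF.
Qed.

Lemma adds_digit_erased N r : r < blocks N ->
  adds_digit (erased N r.+1) (r.*2.+1 - offset N) (erased N r).
Proof.
move=> rk; have s1 := offset_le1 N; apply: adds_digitP.
  suff -> : set_one (fib_digits (erased N r.+1)) (r.*2.+1 - offset N) =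
    erase (offset N) r (fib_digits N) by exact: erasedP.
  apply: funext => j; rewrite erased_digits /set_one /erase.
  case: eqP => [->|ne].
    by rewrite ifF ?in_block //; apply/negP; lia.
  suff -> : odd (j + offset N) && (j + offset N < r.+1.*2) =
            odd (j + offset N) && (j + offset N < r.*2) by [].
  by apply/idP/idP; lia.
by rewrite erased_digits /erase ifT //; lia.
Qed.

Lemma erased_blocks_low N j : j <= (blocks N).*2.+1 - offset N ->
  fib_digits (erased N (blocks N)) j = 0.
Proof.
move=> jk; have s1 := offset_le1 N; rewrite erased_digits /erase; case: ifP => // h.
case: (boolP (odd (j + offset N))) h => /= oj h.
  have -> : j = (blocks N).*2.+1 - offset N by lia.
  exact: block_end.
have [i ji] : exists i, j + offset N = i.*2 by exists (j + offset N)./2; lia.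
have -> : j = i.*2 - offset N by lia.
by case: (@even_digit N i) => //; lia.
Qed.

(** Telescoping of [F_(j+1) + F_j = F_(j+2)] along the erased blocks.  For
    [r = 0] and offset 1 the truncated subtraction gives [F_0 = 1], which is the
    value wanted there. *)
Lemma succ_erased N r : r <= blocks N ->
  N.+1 = erased N r + fib (r.*2 - offset N).
Proof.
have s1 := offset_le1 N; elim: r => [_|r IH rk].
  by rewrite erased0 /= sub0n addn1.
rewrite IH 1?ltnW // (adds_digit_fib (adds_digit_erased rk)) -addnA; congr (_ + _).
case: r {IH} rk => [|r] rk.
  by case E : (offset N) s1 => [|[|?]].
have -> : r.+2.*2 - offset N = (r.*2.+2 - offset N).+2 by lia.
by rewrite fibSS; congr (fib _ + fib _); lia.
Qed.

Lemma adds_digit_succ N :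
  adds_digit (erased N (blocks N)) ((blocks N).*2 - offset N) N.+1.
Proof.
have s1 := offset_le1 N; have := @blocks_gt0 N => kp.
apply: adds_digitP; last by rewrite erased_blocks_low //; lia.
rewrite (succ_erased (leqnn _)); apply: fib_expansion_set_one.
- exact: fib_digitsP.
- by rewrite erased_blocks_low //; lia.
- by rewrite erased_blocks_low //; lia.
- by rewrite erased_blocks_low //; lia.
Qed.

Definition pad x : nat -> nat := fun j => if j is j'.+1 then x j' else 0.

Lemma carry_odd_pad x e i : x 0 = 1 -> carry_odd x e i = carry_even (pad x) e i.
Proof.
move=> x0; elim: i => // -[|i] IH; first by rewrite /= x0 !muln1.
by rewrite [LHS]/= [RHS]/= -[RHS]/(e i.+1 * carry_even (pad x) e i.+1 * _) -IH.
Qed.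

Lemma new_digits_pad x e : x 0 = 1 ->
  new_digits x e = fun j => new_digits_even (pad x) e j.+1.
Proof.
move=> x0; apply: funext => j; rewrite /new_digits x0 /= /new_digits_odd.
case: j => [|j]; first by rewrite /new_digits_even /= x0; case: (e 0).
rewrite /new_digits_even carry_odd_pad // [RHS]/= negbK /uphalf /=.
by case: (odd j).
Qed.

(** The machine on digits whose first block starts at position 0. *)
Section carries.
Variables (z : nat -> nat) (e : nat -> bool) (k : nat).
Hypothesis z0 : forall i, i <= k -> z i.*2 = 0.
Hypothesis z1 : forall i, i < k -> z i.*2.+1 = 1.
Hypothesis zk : z k.*2.+1 = 0.

Lemma carry_even_one i : i <= k -> (forall j, j < i -> e j) ->
  carry_even z e i = 1.
Proof.
elim: i => // i IH ik eT /=; rewrite eT // IH ?(ltnW ik) //; last first.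
  by move=> j ji; apply: eT; lia.
by rewrite mul2n z1.
Qed.

Lemma carry_even_zero i j : i <= j -> carry_even z e i = 0 ->
  carry_even z e j = 0.
Proof.
move=> /subnK <-; elim: (j - i) => // n IH h.
by rewrite addSn /= IH // muln0.
Qed.

Lemma new_digits_stop r : r <= k -> (forall i, i < r -> e i) -> ~~ e r ->
  new_digits_even z e = erase 0 r z.
Proof.
move=> rk eT eF; apply: funext => j; rewrite /new_digits_even /erase addn0.
have [jr|jr|jr] := ltngtP j./2 r.
- rewrite carry_even_one ?eT //; [|lia|by move=> i ir; apply: eT; lia].
  case: ifP => oj /=.
    have -> : j = j./2.*2.+1 by lia.
    by rewrite z1 ?ifT //; lia.
  have jE : j = j./2.*2 by lia.
  by rewrite jE z0 -?jE; last lia; have := @z1 j./2; rewrite -jE => -> //; lia.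
- rewrite (@carry_even_zero r.+1) //=; last by rewrite (negbTE eF).
  by rewrite !muln0 add0n addn0 !divn1 if_same ifF //; lia.
- by rewrite jr (negbTE eF) !mul0n add0n addn0 !divn1 if_same ifF //; lia.
Qed.

Lemma new_digits_through : (forall i, i <= k -> e i) ->
  new_digits_even z e = set_one (erase 0 k z) k.*2.
Proof.
move=> eT; apply: funext => j; rewrite /new_digits_even /erase /set_one addn0.
have [jr|jr|jr] := ltngtP j./2 k.
- rewrite carry_even_one ?eT //; [|lia|lia|by move=> i ir; apply: eT; lia].
  have -> : (j == k.*2) = false by lia.
  case: ifP => oj /=.
    have -> : j = j./2.*2.+1 by lia.
    by rewrite z1 ?ifT //; lia.
  have jE : j = j./2.*2 by lia.
  by rewrite jE z0 -?jE; last lia; have := @z1 j./2; rewrite -jE => -> //; lia.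
- rewrite (@carry_even_zero k.+1) //=; last by rewrite mul2n zk muln0.
  have -> : (j == k.*2) = false by lia.
  by rewrite !muln0 add0n addn0 !divn1 if_same ifF //; lia.
- rewrite jr carry_even_one // ?eT //; last by move=> i ik; apply: eT; lia.
  case: ifP => oj /=.
    have -> : j = k.*2.+1 by lia.
    by rewrite zk div0n if_same ifF //; lia.
  have jE : j = k.*2 by lia.
  by rewrite jE z0 // zk eqxx.
Qed.

End carries.

(** Digits of [N] with the padding that lets the blocks start at 0. *)
Definition aligned N := if offset N == 0 then fib_digits N else pad (fib_digits N).

Lemma alignedE N j : offset N <= j ->
  aligned N j = fib_digits N (j - offset N).
Proof.
rewrite /aligned; have := offset_le1 N.
by case: (offset N) => [|[|?]] //= _; rewrite ?subn0 ?subn1 //; case: j.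
Qed.

Lemma aligned_even N i : i <= blocks N -> aligned N i.*2 = 0.
Proof.
move=> ik; have s1 := offset_le1 N.
case: (ltnP i.*2 (offset N)) => [i0|si]; last rewrite alignedE //.
  have -> : i = 0 by lia.
  by rewrite /aligned ifF //; lia.
by case: (even_digit ik) => // -[i0 s]; move: si; rewrite i0 s.
Qed.

Lemma new_digits_aligned N e : new_digits (fib_digits N) e =
  fun j => new_digits_even (aligned N) e (j + offset N).
Proof.
rewrite /aligned; case E : (offset N) (offset_le1 N) => [|[|?]] // _ /=.
  by apply: funext => j; rewrite addn0 /new_digits ifT //; apply/eqP.
by rewrite new_digits_pad //; apply: funext => j; rewrite addn1.
Qed.

Lemma fib_step_stop N e r : r <= blocks N -> (forall i, i < r -> e i) -> ~~ e r ->
  fib_step e N = erased N r.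
Proof.
move=> rk eT eF; have s1 := offset_le1 N.
rewrite /fib_step /erased; congr fibval; rewrite new_digits_aligned.
rewrite (@new_digits_stop _ _ (blocks N) _ _ _ r) //.
- apply: funext => j; rewrite /erase addn0 alignedE ?leq_addl //.
  by rewrite addnK.
- exact: aligned_even.
- by move=> i ik; rewrite alignedE ?in_block //; lia.
- by rewrite alignedE ?block_end //; lia.
Qed.

Lemma fib_step_succ N e : (forall i, i <= blocks N -> e i) ->
  fib_step e N = N.+1.
Proof.
move=> eT; have s1 := offset_le1 N; have kp := @blocks_gt0 N.
rewrite /fib_step -[RHS]fibval_digits; congr fibval; rewrite new_digits_aligned.
rewrite (@new_digits_through _ _ (blocks N)) //.
- have [_ ->] := adds_digit_succ N.
  apply: funext => j; rewrite erased_digits /set_one /erase addn0.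
  rewrite alignedE ?leq_addl // addnK.
  suff -> : (j + offset N == (blocks N).*2) = (j == (blocks N).*2 - offset N) by [].
  by lia.
- exact: aligned_even.
- by move=> i ik; rewrite alignedE ?in_block //; lia.
- by rewrite alignedE ?block_end //; lia.
Qed.

(** The states reachable from [N], indexed by the number [r] of successful
    draws before the first failure, with [r = blocks N + 1] for the absence of
    failure. *)
Definition outcome N r : nat := if r <= blocks N then erased N r else N.+1.

Lemma outcome0 N : outcome N 0 = N. Proof. by rewrite /outcome erased0. Qed.

Lemma outcome_last N : outcome N (blocks N).+1 = N.+1.
Proof. by rewrite /outcome ltnn. Qed.

Lemma outcome_le N r : outcome N r <= N.+1.
Proof.
rewrite /outcome; case: ifP => // rk.
by rewrite [X in _ <= X](succ_erased rk) leq_addr.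
Qed.

Lemma adds_digit_outcome N r : r < blocks N ->
  adds_digit (outcome N r.+1) (r.*2.+1 - offset N) (outcome N r).
Proof.
by move=> rk; rewrite /outcome rk (ltnW rk); exact: adds_digit_erased.
Qed.

Lemma adds_digit_outcome_last N :
  adds_digit (outcome N (blocks N)) ((blocks N).*2 - offset N) N.+1.
Proof. by rewrite /outcome leqnn; exact: adds_digit_succ. Qed.

Lemma outcome_blocks_low N j : j <= (blocks N).*2.+1 - offset N ->
  fib_digits (outcome N (blocks N)) j = 0.
Proof. by rewrite /outcome leqnn; exact: erased_blocks_low. Qed.

Lemma fib_step_outcome N e r : r <= (blocks N).+1 ->
  (forall i, i < r -> e i) -> (r <= blocks N -> ~~ e r) ->
  fib_step e N = outcome N r.
Proof.
rewrite leq_eqVlt => /predU1P[->|rk] eT eF.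
  by rewrite outcome_last; apply: fib_step_succ.
by rewrite /outcome -ltnS rk; apply: fib_step_stop => //; exact: eF.
Qed.

End step_structure.

(** * The one-step mean and the maximum principle *)

Section height.
Local Open Scope nat_scope.

Lemma adds_digit_fib0 i : adds_digit 0 i (fib i).
Proof.
have D0 j : fib_digits 0 j = 0 by rewrite fib_digits_large.
apply: adds_digitP => //; rewrite -[fib i]add0n.
by apply: fib_expansion_set_one; rewrite ?D0 //; exact: fib_digitsP.
Qed.

(** One plus the position of the top digit, and 0 for [N = 0].  Written as a
    maximum over the digits, it commutes with [adds_digit]. *)
Definition height N : nat := \max_(i < N) fib_digits N i * i.+1.

Lemma height_widen N K : N <= K ->
  height N = \max_(i < K) fib_digits N i * i.+1.
Proof.
move=> NK; rewrite /height (big_ord_widen K (fun i => fib_digits N i * i.+1) NK).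
rewrite big_mkcond /=; apply: eq_bigr => i _; case: ltnP => // Ni.
by rewrite fib_digits_large.
Qed.

Lemma height_adds M i N : adds_digit M i N -> height N = maxn (height M) i.+1.
Proof.
move=> MiN; have NE := adds_digit_fib MiN; have := MiN => -[M0 DN].
have iK : i < N + i.+1 by lia.
rewrite (@height_widen N (N + i.+1)) ?leq_addr //.
rewrite (@height_widen M (N + i.+1)); last by rewrite NE; lia.
rewrite DN (bigD1 (Ordinal iK)) //= [in RHS](bigD1 (Ordinal iK)) //=.
rewrite {1}/set_one eqxx M0 mul0n mul1n max0n maxnC; congr (maxn _ _).
by apply: eq_bigr => -[j jK]; rewrite -val_eqE /= /set_one => /negbTE ->.
Qed.

Lemma height_le N : height N <= N.
Proof.
apply/bigmax_leqP => i _; apply: (@leq_trans i.+1) => //.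
by rewrite -[X in _ <= X]mul1n leq_mul2r fib_digits_le1 orbT.
Qed.

Lemma height_fib n : height (fib n) = n.+1.
Proof.
by rewrite (height_adds (adds_digit_fib0 n)) /height big_ord0 max0n.
Qed.

Lemma height_digit N : 0 < N -> exists2 i, height N = i.+1 & fib_digits N i = 1.
Proof.
move=> N0; pose F (i : 'I_N) := fib_digits N i * i.+1.
have [j jE] : {j : 'I_N | height N = F j}.
  by apply: bigop.eq_bigmax; rewrite card_ord.
have := fib_digits_le1 N j; rewrite leq_eqVlt => /predU1P[j1|].
  by exists j => //; rewrite jE /F j1 mul1n.
rewrite ltnS leqn0 => /eqP j0; have h0 : height N = 0 by rewrite jE /F j0.
suff : N = 0 by lia.
rewrite -(fibval_digits N) (@fibvalE 0) ?big_geq // => i _.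
case: (ltnP i N) => [iN|]; last exact: fib_digits_large.
have : F (Ordinal iN) <= height N by exact: (leq_bigmax (Ordinal iN)).
by rewrite h0 /F /=; case: (fib_digits N i).
Qed.

End height.

Section kernel.
Local Open Scope ring_scope.
Variables (R : realType) (p : nat -> R).
Hypothesis hp : forall i, 0 < p i.+1 <= 1.
Implicit Types (f g : nat -> R) (N : nat).

Let p_gt0 i : 0 < p i.+1. Proof. by case/andP: (hp i). Qed.
Let p_le1 i : p i.+1 <= 1. Proof. by case/andP: (hp i). Qed.

(** Probability that the first [n] draws succeed. *)
Definition carry_prob n : R := \prod_(i < n) p i.+1.

Lemma carry_probS n : carry_prob n.+1 = carry_prob n * p n.+1.
Proof. by rewrite /carry_prob big_ord_recr. Qed.

Lemma carry_prob_gt0 n : 0 < carry_prob n.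
Proof. by apply: prodr_gt0 => i _. Qed.

(** Law of [outcome]: for [r <= k] the draw [r] fails after [r] successes. *)
Definition outcome_prob k r : R :=
  if (r <= k)%N then carry_prob r - carry_prob r.+1 else carry_prob r.

Lemma outcome_prob_ge0 k r : 0 <= outcome_prob k r.
Proof.
rewrite /outcome_prob; case: ifP => _; last exact/ltW/carry_prob_gt0.
by rewrite subr_ge0 carry_probS ler_piMr // ltW // carry_prob_gt0.
Qed.

(** The transition operator of the chain: the mean of [f] after one step from
    [N]. *)
Definition mean f N : R :=
  \sum_(r < (blocks N).+2) outcome_prob (blocks N) r * f (outcome N r).

(** Summation by parts replaces the law of the outcome by its tails and the
    values of [f] by its increments along [adds_digit]. *)
Lemma mean_by_parts f N : mean f N = f N +
  \sum_(r < (blocks N).+1)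
    carry_prob r.+1 * (f (outcome N r.+1) - f (outcome N r)).
Proof.
rewrite /mean big_ord_recr /= -[X in _ = f X + _](outcome0 N).
rewrite {2}/outcome_prob ltnn.
rewrite (eq_bigr (fun r : 'I__ =>
  (carry_prob r - carry_prob r.+1) * f (outcome N r))); last first.
  by move=> r _; rewrite /outcome_prob -ltnS ltn_ord.
elim: (blocks N).+1 => [|n IH].
  by rewrite !big_ord0 /carry_prob big_ord0 mul1r add0r addr0.
rewrite !big_ord_recr /= addrA -IH; ring.
Qed.

Lemma mean_cst c N : mean (fun=> c) N = c.
Proof.
by rewrite mean_by_parts big1 ?addr0 // => r _; rewrite subrr mulr0.
Qed.

Lemma le_mean f g N : (forall y, (y <= N.+1)%N -> f y <= g y) ->
  mean f N <= mean g N.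
Proof.
move=> fg; apply: ler_sum => r _; apply: ler_wpM2l; first exact: outcome_prob_ge0.
exact/fg/outcome_le.
Qed.

Lemma eq_mean f g N : f =1 g -> mean f N = mean g N.
Proof. by move=> fg; apply: eq_bigr => r _; rewrite fg. Qed.

Lemma meanD f g N : mean (fun y => f y + g y) N = mean f N + mean g N.
Proof. by rewrite -big_split; apply: eq_bigr => r _; rewrite mulrDr. Qed.

Lemma meanZ c f N : mean (fun y => c * f y) N = c * mean f N.
Proof. by rewrite mulr_sumr; apply: eq_bigr => r _; rewrite mulrCA. Qed.

Lemma meanB f g N : mean (fun y => f y - g y) N = mean f N - mean g N.
Proof.
rewrite (eq_mean _ (g := fun y => f y + (-1) * g y)) ?meanD ?meanZ ?mulN1r //.
by move=> y; rewrite mulN1r.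
Qed.

Lemma mean_ge0 f N : (forall y, 0 <= f y) -> 0 <= mean f N.
Proof.
by move=> f0; apply: sumr_ge0 => r _; apply: mulr_ge0 => //; exact: outcome_prob_ge0.
Qed.

Lemma mean_ge_up f N : (forall y, 0 <= f y) ->
  carry_prob (blocks N).+1 * f N.+1 <= mean f N.
Proof.
move=> f0; rewrite /mean big_ord_recr /= outcome_last {2}/outcome_prob ltnn.
rewrite lerDr; apply: sumr_ge0 => r _; apply: mulr_ge0 => //.
exact: outcome_prob_ge0.
Qed.

Lemma mean_cvg (F : nat -> nat -> R) f N :
  (forall y, F n y @[n --> \oo] --> f y) -> mean (F n) N @[n --> \oo] --> mean f N.
Proof.
move=> Ff; rewrite /mean; apply: cvg_big => [|r _]; first exact: add_continuous.
apply: cvgMr; exact: Ff.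
Qed.

(** A positive maximum of [f] on [0, K] is attained at a point where [f] is at
    most its mean.  The successor of that point has positive weight in the
    mean, so it is a maximum too, and so on up to [K], where [f <= 0]. *)
Lemma maximum_principle f K :
  (forall x, (x < K)%N -> f x <= 0 \/ f x <= mean f x) -> f K <= 0 ->
  forall x, (x <= K)%N -> f x <= 0.
Proof.
move=> fK K0.
pose i0 : 'I_K.+1 := [arg max_(i > (ord0 : 'I_K.+1)) f i]%O.
have fi0 x : (x <= K)%N -> f x <= f i0.
  move=> xK; rewrite /i0; case: arg_maxP => // i _ /(_ (Ordinal (xK : (x < K.+1)%N))).
  exact.
move=> x xK; apply: le_trans (fi0 x xK) _; rewrite leNgt; apply/negP => M0.
have upward n : (i0 + n <= K)%N -> f (i0 + n)%N = f i0.
  elim: n => [|n IH]; first by rewrite addn0.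
  rewrite addnS => nK; have {}IH := IH (ltnW nK).
  have [|h] := fK _ nK; first by rewrite IH leNgt M0.
  apply/eqP; rewrite eq_le fi0 //= -subr_le0.
  have : mean (fun y => f i0 - f y) (i0 + n)%N <= 0.
    by rewrite meanB mean_cst subr_le0 -IH.
  rewrite /mean big_ord_recr /= outcome_last {2}/outcome_prob ltnn => h0.
  rewrite -(pmulr_rle0 _ (carry_prob_gt0 (blocks (i0 + n)).+1)).
  apply: le_trans h0; rewrite lerDr; apply: sumr_ge0 => r _.
  apply: mulr_ge0; first exact: outcome_prob_ge0.
  by rewrite subr_ge0 fi0 // (leq_trans (outcome_le _ _)).
have := upward (K - i0)%N; rewrite subnKC -1?ltnS // => /(_ (leqnn _)) h.
by move: K0; rewrite h leNgt M0.
Qed.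

(** * The harmonic function and the ascent time *)

(** The chain leaves the states from [F_(m-1)] to [F_m - 1] through the last one,
    going either to [F_m] or to 0; this is the probability of the former.  Indeed
    [F_m - 1] consists of [uphalf m] blocks, so that the draw [uphalf m] decides
    between the two.  For [m = 0] there is only the state 0. *)
Definition pass_prob m : R := p (uphalf m).+1.

(** Probability of reaching [F_m] from 0 before coming back to 0. *)
Definition reach_prob m : R := \prod_(i < m.+1) pass_prob i.

Lemma reach_probS m : reach_prob m.+1 = reach_prob m * pass_prob m.+1.
Proof. by rewrite /reach_prob big_ord_recr. Qed.

Lemma pass_prob_gt0 m : 0 < pass_prob m. Proof. exact: p_gt0. Qed.

Lemma reach_prob_gt0 m : 0 < reach_prob m.
Proof. by apply: prodr_gt0 => i _; exact: pass_prob_gt0. Qed.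

Definition escape_level m : R := if m is n.+1 then (reach_prob n)^-1 else 0.

Lemma escape_level_le m n : (m <= n)%N -> escape_level m <= escape_level n.
Proof.
move=> /subnK <-; elim: (n - m)%N => // k /le_trans; apply.
rewrite addSn; case: (k + m)%N => [|j] /=; first by rewrite invr_ge0 ltW ?reach_prob_gt0.
rewrite lef_pV2 ?posrE ?reach_prob_gt0 // reach_probS ler_piMr ?p_le1 //.
exact/ltW/reach_prob_gt0.
Qed.

(** Proportional to the probability of reaching a fixed high Fibonacci number
    before 0. *)
Definition escape N : R := escape_level (height N).

Lemma escape_ge0 N : 0 <= escape N.
Proof. exact: (@escape_level_le 0). Qed.

(** Either some nonzero digit of [N] lies beyond its leading blocks, and then all
    outcomes have the height of [N]; or [N = F_(m+1) - 1] with [m] the position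
    of its top digit.  In that case the outcomes keep the height of [N] as long
    as one block is left, and the remaining two, 0 and [F_(m+1)], balance by
    the choice of [pass_prob]. *)
Lemma mean_escape N : (0 < N)%N -> mean escape N = escape N.
Proof.
move=> N0; rewrite mean_by_parts -[RHS]addr0; congr (_ + _).
have s1 := offset_le1 N; set k := blocks N; set o := offset N in s1.
have hS r : (r < k)%N ->
    height (outcome N r) = maxn (height (outcome N r.+1)) (r.*2.+2 - o).
  move=> rk; rewrite (height_adds (adds_digit_outcome rk)); congr (maxn _ _).
  by rewrite -/o; lia.
have hl : height N.+1 = maxn (height (outcome N k)) (k.*2.+1 - o).
  rewrite (height_adds (adds_digit_outcome_last N)) -/o -/k; congr (maxn _ _).
  by have := @blocks_gt0 N; rewrite -/o -/k; lia.
have [h0|hgt] := posnP (height (outcome N k)).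
- have k0 : (0 < k)%N.
    rewrite lt0n; apply/eqP => k0; move: h0; rewrite k0 outcome0.
    by have [i ->] := height_digit N0.
  have hr r : (r < k)%N -> height (outcome N r) = (k.*2 - o)%N.
    move=> rk; have [d dE] : exists d, k = (r + d.+1)%N by exists (k - r.+1)%N; lia.
    elim: d r rk dE => [|d IH] r rk dE; rewrite hS //.
      have -> : r.+1 = k by lia.
      by rewrite h0 max0n; lia.
    by rewrite IH; lia.
  have [k' kE] : exists k', k = k'.+1 by exists k.-1; lia.
  (* only the increments from one block to none and from none to N + 1 remain *)
  rewrite kE 2!big_ord_recr /= big1 => [|r _]; last first.
    by rewrite /escape !hr ?subrr ?mulr0 //; have := ltn_ord r; lia.
  rewrite -kE outcome_last /escape h0 hr ?kE // -kE hl h0 max0n /= add0r.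
  rewrite sub0r subr0.
  have [m mE] : exists m, (k.*2 - o)%N = m.+1 by exists (k.*2 - o).-1; lia.
  have -> : (k.*2.+1 - o)%N = m.+2 by lia.
  rewrite mE /= carry_probS reach_probS.
  have -> : pass_prob m.+1 = p k.+1 by rewrite /pass_prob; congr p; lia.
  have := p_gt0 k; have := reach_prob_gt0 m => Q0 P0.
  by field; rewrite !gt_eqF.
- have hk : (k.*2.+3 - o <= height (outcome N k))%N.
    have y0 : (0 < outcome N k)%N.
      by rewrite lt0n; apply: contraTN hgt => /eqP ->; rewrite /height big_ord0.
    have [i -> i1] := height_digit y0; have := @outcome_blocks_low N i.
    by rewrite i1 -/o -/k; lia.
  have hr r : (r <= k)%N -> height (outcome N r) = height (outcome N k).
    move=> rk; have [d dE] : exists d, k = (r + d)%N by exists (k - r)%N; lia.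
    elim: d r rk dE => [|d IH] r rk dE; first by rewrite dE addn0.
    rewrite hS; last lia.
    by rewrite IH; lia.
  rewrite big1 // => -[r /= rk] _.
  have hrS : height (outcome N r.+1) = height (outcome N k).
    move: rk; rewrite ltnS leq_eqVlt => /predU1P[->|rk]; last exact: hr.
    by rewrite outcome_last hl; lia.
  by rewrite /escape hrS hr -1?ltnS // subrr mulr0.
Qed.

(** [level_time m.+1] is the mean time needed to climb from 0 to [F_m]; the
    value at 0 corresponds to [F_(-1) = 1].  After reaching [F_(m-1)], the chain
    behaves as if started at 0 and climbing to [F_(m-2)], until it goes to [F_m]
    with probability [pass_prob m] or starts again from 0. *)
Fixpoint level_time m : R := match m with
  | 0 => (p 1)^-1
  | n.+1 => match n with
            | 0 => (p 1)^-1
            | k.+1 => (level_time n + level_time k) / pass_prob n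
            end
  end.

Lemma level_timeSS m :
  level_time m.+2 = (level_time m.+1 + level_time m) / pass_prob m.+1.
Proof. by []. Qed.

Lemma level_time_gt0 m : 0 < level_time m.
Proof.
suff : 0 < level_time m /\ 0 < level_time m.+1 by case.
elim: m => [|m [h1 h2]]; first by rewrite /= invr_gt0 p_gt0.
by rewrite level_timeSS divr_gt0 ?addr_gt0 ?pass_prob_gt0.
Qed.

(** Mean time needed to climb from 0 to [N].  It is additive over the digits
    because, above its top digit, the chain moves like the chain of the
    remaining digits. *)
Definition ascent_time N : R := \sum_(i < N) (fib_digits N i)%:R * level_time i.+1.

Lemma ascent_time_widen N K : (N <= K)%N ->
  ascent_time N = \sum_(i < K) (fib_digits N i)%:R * level_time i.+1.
Proof.
move=> NK; rewrite /ascent_time.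
rewrite (big_ord_widen K (fun i => (fib_digits N i)%:R * level_time i.+1) NK).
rewrite big_mkcond /=; apply: eq_bigr => i _; case: ltnP => // Ni.
by rewrite fib_digits_large // mul0r.
Qed.

Lemma ascent_time_adds M i N : adds_digit M i N ->
  ascent_time N = ascent_time M + level_time i.+1.
Proof.
move=> MiN; have NE := adds_digit_fib MiN; have := MiN => -[M0 DN].
have iK : (i < N + i.+1)%N by lia.
rewrite (@ascent_time_widen N (N + i.+1)) ?leq_addr //.
rewrite (@ascent_time_widen M (N + i.+1)); last by rewrite NE; lia.
rewrite DN (bigD1 (Ordinal iK)) //= [in RHS](bigD1 (Ordinal iK)) //=.
rewrite {1}/set_one eqxx M0 mul0r mul1r add0r addrC; congr (_ + _).
by apply: eq_bigr => -[j jK]; rewrite -val_eqE /= /set_one => /negbTE ->.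
Qed.

Lemma ascent_time_ge0 N : 0 <= ascent_time N.
Proof.
by apply: sumr_ge0 => i _; rewrite mulr_ge0 ?ler0n ?ltW ?level_time_gt0.
Qed.

Lemma ascent_time_fib n : ascent_time (fib n) = level_time n.+1.
Proof.
by rewrite (ascent_time_adds (adds_digit_fib0 n)) /ascent_time big_ord0 add0r.
Qed.

(** Erasing blocks costs the level times of the erased digits; the recursion
    of [level_time] makes these costs telescope against the gain of the step to
    [N + 1], leaving [carry_prob 1 / p 1 = 1]. *)
Lemma mean_ascent_time N : mean ascent_time N = ascent_time N + 1.
Proof.
have s1 := offset_le1 N; have kp := @blocks_gt0 N.
rewrite mean_by_parts; congr (_ + _).
rewrite big_ord_recr /= outcome_last (ascent_time_adds (adds_digit_outcome_last N)).
rewrite [X in _ * X]addrAC subrr add0r.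
rewrite (eq_bigr (fun r : 'I__ =>
  - (carry_prob r.+1 * level_time (r.*2.+2 - offset N)))); last first.
  move=> r _; rewrite (ascent_time_adds (adds_digit_outcome (ltn_ord r))).
  rewrite opprD addrA subrr add0r mulrN.
  by have -> : (r.*2.+1 - offset N).+1 = (r.*2.+2 - offset N)%N by lia.
have -> : ((blocks N).*2 - offset N).+1 = ((blocks N).*2.+1 - offset N)%N by lia.
move: (offset N) s1 {kp} => o o1; elim: (blocks N) => [|k IH].
  rewrite big_ord0 add0r /carry_prob big_ord1.
  by case: o o1 => [|[|?]] //= _; rewrite divff // gt_eqF.
rewrite big_ord_recr /= -[RHS]IH -addrA; congr (_ + _).
have -> : (k.+1.*2.+1 - o = (k.*2.+1 - o).+2)%N by lia.
rewrite level_timeSS (carry_probS k.+1).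
have -> : (k.*2.+2 - o = (k.*2.+1 - o).+1)%N by lia.
have -> : pass_prob (k.*2.+1 - o).+1 = p k.+2 by rewrite /pass_prob; congr p; lia.
by have := p_gt0 k.+1 => P0; field; rewrite gt_eqF.
Qed.

(** With [a_n] the product of [reach_prob n] and [level_time n.+1], the
    recursions give [a_(n+2) = a_(n+1) + pass_prob n.+1 * a_n], and [a_n >= 1].
    For [i >= 2], [p i] is [pass_prob] of an odd level; the term [p 1 <= 1] is
    absorbed by [a_1 >= 1]. *)
Lemma reach_prob_level_time_ge k :
  \sum_(i < k.+1) p i.+1 <= reach_prob k.*2.+1 * level_time k.*2.+2.
Proof.
have aS n : reach_prob n.+1 * level_time n.+2 =
    reach_prob n * level_time n.+1 + reach_prob n * level_time n.
  rewrite reach_probS level_timeSS; have := pass_prob_gt0 n.+1 => P0.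
  by field; rewrite gt_eqF.
have a_mono n : reach_prob n * level_time n.+1 <= reach_prob n.+1 * level_time n.+2.
  by rewrite aS lerDl mulr_ge0 ?ltW ?reach_prob_gt0 ?level_time_gt0.
have a1 n : 1 <= reach_prob n * level_time n.+1.
  elim: n => [|n /le_trans]; last exact.
  by rewrite /reach_prob big_ord1 /pass_prob /= divff // gt_eqF.
have a_step n : reach_prob n.+1 * level_time n.+2 + pass_prob n.+1 <=
    reach_prob n.+2 * level_time n.+3.
  rewrite [X in _ <= X]aS lerD2l reach_probS mulrAC ler_peMl //.
  exact/ltW/pass_prob_gt0.
elim: k => [|k IH].
  by rewrite big_ord1 /=; apply: le_trans (p_le1 0) (a1 1).
rewrite big_ord_recr /=; apply: le_trans (a_mono _).
apply: le_trans (a_step _); apply: lerD => //.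
by rewrite /pass_prob; have -> : uphalf k.*2.+1 = k.+1 by lia.
Qed.

End kernel.

(** * Probability of avoiding a state, and its sum *)

Section survival.
Local Open Scope ring_scope.
Variables (R : realType) (p : nat -> R).
Hypothesis hp : forall i, 0 < p i.+1 <= 1.
Variable a : nat.

(** Probability that the chain started at [x] is different from [a] at the
    times 1 to [n]. *)
Fixpoint survival n (x : nat) : R :=
  if n is n'.+1 then mean p (fun y => if y == a then 0 else survival n' y) x
  else 1.

Definition killed n (x : nat) : R := if x == a then 0 else survival n x.

Lemma survivalS n x : survival n.+1 x = mean p (killed n) x. Proof. by []. Qed.

Lemma survival_ge0 n x : 0 <= survival n x.
Proof.
elim: n x => //= n IH x; apply: (mean_ge0 hp) => y; case: ifP => // _; exact: IH.
Qed.

Lemma survival_le1 n x : survival n x <= 1.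
Proof.
elim: n x => //= n IH x; rewrite -[leRHS](mean_cst p 1 x).
by apply: (le_mean hp) => y _; case: ifP.
Qed.

Lemma survival_nonincreasing x : nonincreasing_seq (survival ^~ x).
Proof.
apply/nonincreasing_seqP => n; elim: n x => [|n IH] x; first exact: survival_le1.
by apply: (le_mean hp) => y _; case: ifP => // _; exact: IH.
Qed.

Lemma cvg_survival x : cvgn (survival ^~ x).
Proof.
apply: nonincreasing_is_cvgn; first exact: survival_nonincreasing.
by exists 0 => _ [n _ <-]; exact: survival_ge0.
Qed.

Section recurrence.
Hypothesis reach0 : forall eps, 0 < eps -> exists2 n, (a < n)%N & reach_prob p n < eps.

(** The limit [v] of [killed] is harmonic off [a].  By the maximum principle it
    vanishes up to [a], and is then dominated up to [F_m] by [escape] normalised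
    to be 1 at [F_m].  The hypothesis on [reach_prob] says that [escape] is
    unbounded. *)
Lemma survival_to0 x : survival n x @[n --> \oo] --> (0 : R).
Proof.
pose u (y : nat) : R := limn (survival ^~ y).
have uP y : survival n y @[n --> \oo] --> u y by exact: cvg_survival.
pose v (y : nat) : R := if y == a then 0 else u y.
have vP y : killed n y @[n --> \oo] --> v y.
  by rewrite /killed /v; case: ifP => _; [exact: cvg_cst|exact: uP].
have u_mean y : u y = mean p v y.
  apply: (@cvg_unique _ _ (survival n.+1 y @[n --> \oo])) => //.
    by move: (uP y); rewrite -(cvg_shiftS (survival ^~ y)).
  exact: mean_cvg vP.
have v_ge0 y : 0 <= v y.
  rewrite /v; case: ifP => // _.
  by apply: limr_ge; [exact: cvg_survival|apply: nearW => n; exact: survival_ge0].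
have v_le1 y : v y <= 1.
  rewrite /v; case: ifP => // _.
  by apply: limr_le; [exact: cvg_survival|apply: nearW => n; exact: survival_le1].
have v_low y : (y <= a)%N -> v y <= 0.
  apply: (maximum_principle hp) => [z za|]; last by rewrite /v eqxx.
  by right; rewrite {1}/v ltn_eqF // u_mean.
suff v0 y : v y = 0.
  suff <- : u x = 0 by exact: uP.
  rewrite u_mean -(mean_cst p 0 x); exact: eq_mean.
apply/eqP; rewrite eq_le v_ge0 andbT; apply/ler_addgt0Pl => eps eps0; rewrite addr0.
have E0 := escape_ge0 hp y.
have E1 : 0 < escape p y + 1 by rewrite ltr_wpDl.
have [n an rn] := reach0 (divr_gt0 eps0 E1).
have n_large : exists2 m, (n <= m)%N &
    (y <= fib m)%N /\ reach_prob p m < eps / (escape p y + 1).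
  exists (n + y)%N; rewrite ?leq_addr //; split.
    apply: leq_trans (ltnW (ltn_fib y)) _; apply: fib_homo; lia.
  apply: le_lt_trans rn.
  rewrite -[leLHS]invrK -[leRHS]invrK lef_pV2 ?posrE ?invr_gt0 ?reach_prob_gt0 //.
  by apply: (@escape_level_le _ _ hp n.+1 (n + y).+1); lia.
have [m nm [ym rm]] := n_large.
have escm : reach_prob p m * escape p (fib m) = 1.
  by rewrite /escape height_fib /= divff // gt_eqF // reach_prob_gt0.
have h : v y - reach_prob p m * escape p y <= 0.
  apply: (@maximum_principle _ _ hp (fun z => v z - reach_prob p m * escape p z) (fib m)) => //.
  - move=> z zm; case: (leqP z a) => [za|az].
      left; rewrite subr_le0 (le_trans (v_low _ za)) //.
      by rewrite mulr_ge0 ?escape_ge0 // ltW // reach_prob_gt0.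
    right; rewrite meanB meanZ mean_escape //; last lia.
    by rewrite {1}/v gtn_eqF // u_mean.
  - by rewrite escm subr_le0.
move: h; rewrite subr_le0 => /le_trans; apply.
apply: (@le_trans _ _ (eps / (escape p y + 1) * escape p y)).
  by rewrite ler_wpM2r // ltW.
by rewrite mulrAC ler_pdivrMr // ler_wpM2l ?ltW // ltrDl.
Qed.

End recurrence.

(** Mean of the minimum of [n] and of the first time after 0 at which the
    chain started at [x] is at [a]. *)
Definition truncated_time n x : R := \sum_(i < n) survival i x.

Lemma truncated_time_ge0 n x : 0 <= truncated_time n x.
Proof. by apply: sumr_ge0 => i _; exact: survival_ge0. Qed.

Definition killed_time n x : R := if x == a then 0 else truncated_time n x.

Lemma truncated_timeS n x : truncated_time n.+1 x = 1 + mean p (killed_time n) x.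
Proof.
rewrite /truncated_time big_ord_recl /=; congr (_ + _); rewrite /mean.
rewrite exchange_big /=; apply: eq_bigr => r _; rewrite -mulr_sumr; congr (_ * _).
rewrite /killed_time /killed; case: ifP => // _; exact: big1.
Qed.

(** The step to [x + 1] has positive probability, so the mean hitting time
    from [x + 1] is controlled by the one from [x]. *)
Lemma truncated_time_step n x : x.+1 != a ->
  carry_prob p (blocks x).+1 * truncated_time n x.+1 <= truncated_time n.+1 x.
Proof.
move=> xa; rewrite truncated_timeS.
have -> : truncated_time n x.+1 = killed_time n x.+1.
  by rewrite /killed_time (negbTE xa).
apply: ler_wpDl => //; apply: (mean_ge_up hp) => y.
by rewrite /killed_time; case: ifP => // _; exact: truncated_time_ge0.
Qed.

(** Stopping at the minimum of [n] and of the hitting time of [a]: a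
    subsolution is at most the elapsed mean time plus its mean final value, which
    is at most [B] and counts only on survival. *)
Lemma subsolution_le_truncated_time (f : nat -> R) B n x : 0 <= B ->
  (forall y, f y <= B) -> f a <= 0 ->
  (forall y, y != a -> f y <= 1 + mean p f y) -> x != a ->
  f x <= truncated_time n x + B * survival n x.
Proof.
move=> B0 fB fa fm; elim: n x => [|n IH] x xa.
  by rewrite /truncated_time big_ord0 /= add0r mulr1.
rewrite truncated_timeS survivalS -meanZ -addrA -meanD.
apply: le_trans (fm x xa) _; rewrite lerD2l; apply: (le_mean hp) => y _.
rewrite /killed_time /killed; case: eqP => [->|/eqP ya].
  by rewrite mulr0 addr0.
exact: IH.
Qed.

Section nullity.
Hypothesis reach0 : forall eps, 0 < eps -> exists2 n, (a < n)%N & reach_prob p n < eps.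
Hypothesis p_sum : forall M, exists n, M <= \sum_(i < n.+1) p i.+1.

Lemma escape_le_state x : (x <= a)%N -> escape p x <= escape_level p a.
Proof.
move=> xa; apply: (escape_level_le hp).
exact: leq_trans (height_le x) xa.
Qed.

Lemma truncated_time_bounded_above :
  (exists M, forall n, truncated_time n a <= M) ->
  forall x, (a <= x)%N -> exists M, forall n, truncated_time n x <= M.
Proof.
move=> ha x ax; rewrite -(subnKC ax); elim: (x - a)%N => [|k [M IH]].
  by rewrite addn0.
exists (M / carry_prob p (blocks (a + k)).+1) => n.
rewrite addnS ler_pdivlMr ?carry_prob_gt0 // mulrC.
apply: le_trans (IH n.+1); apply: truncated_time_step; lia.
Qed.

(** The lower bound is a bounded subsolution that vanishes up to [a] and from
    [F_m] on.  It is tested at the fixed state [F_n0], chosen so high that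
    [escape] exceeds [E + 1] there, while [m] grows. *)
Lemma truncated_time_unbounded M : exists n, M <= truncated_time n a.
Proof.
apply: contrapT => noM.
have ha : exists M, forall n, truncated_time n a <= M.
  exists M => n; apply: ltW; rewrite ltNge; apply/negP => h.
  by apply: noM; exists n.
pose E := escape_level p a.
have E0 : 0 <= E by exact: (@escape_level_le _ _ hp 0).
have [n0 an0 rn0] : exists2 n, (a < n)%N & reach_prob p n < (E + 1)^-1.
  by apply: reach0; rewrite invr_gt0 ltr_wpDl.
have Vn0 : E + 1 < (reach_prob p n0)^-1.
  by rewrite -[ltLHS]invrK ltf_pV2 ?posrE ?reach_prob_gt0 ?invr_gt0 // ltr_wpDl.
have ax0 : (a < fib n0)%N by apply: leq_trans (ltnW (ltn_fib n0)).
have [B hB] := truncated_time_bounded_above ha (ltnW ax0).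
suff low K : exists n, K <= truncated_time n (fib n0).
  have [n] := low (B + 1); rewrite leNgt => /negP; apply.
  by rewrite (le_lt_trans (hB n)) // ltrDl.
have [k0] := p_sum (K + 1 + ascent_time p (fib n0)).
have p_mono k : (k0 <= k)%N -> \sum_(i < k0.+1) p i.+1 <= \sum_(i < k.+1) p i.+1.
  move=> kk; rewrite -!(big_mkord xpredT (fun i => p i.+1)).
  rewrite [leRHS](big_cat_nat _ (n := k0.+1)) //= lerDl sumr_ge0 // => i _.
  by case/andP: (hp i) => /ltW.
have k0le : (k0 <= k0 + n0)%N by lia.
move=> /le_trans /(_ (p_mono _ k0le)) /le_trans /(_ (reach_prob_level_time_ge hp _)).
set k := (k0 + n0)%N; pose m := k.*2.+1; rewrite -/m => hm.
have n0m : (n0 < m)%N by lia.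
have Em : 0 < (reach_prob p m)^-1 - E.
  have := @escape_level_le _ _ hp n0.+1 m.+1 (ltnW n0m : (n0.+1 <= m.+1)%N) => /= h.
  by rewrite subr_gt0; apply: lt_le_trans h; apply: lt_trans Vn0; rewrite ltrDl.
(* the constant for which g vanishes at F_m *)
pose c := level_time p m.+1 / ((reach_prob p m)^-1 - E).
have c_ge : reach_prob p m * level_time p m.+1 <= c.
  rewrite /c mulrC ler_wpM2l ?(ltW (level_time_gt0 hp _)) // -[reach_prob p m]invrK.
  by rewrite lef_pV2 ?posrE ?invrK ?invr_gt0 ?reach_prob_gt0 // gerBl.
have c0 : 0 <= c by rewrite divr_ge0 ?ltW ?level_time_gt0.
pose g x := c * (escape p x - E) - ascent_time p x.
have gm : g (fib m) = 0.
  by rewrite /g /escape height_fib ascent_time_fib /= /c divfK ?subrr // gt_eqF.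
have g_mean x : (0 < x)%N -> mean p g x = g x - 1.
  move=> x0; rewrite /g meanB meanZ meanB mean_cst mean_escape // mean_ascent_time //.
  by rewrite opprD addrA.
have g_low x : (x <= a)%N -> g x <= 0.
  move=> xa; rewrite /g subr_le0 (le_trans _ (ascent_time_ge0 hp x)) //.
  by rewrite mulr_ge0_le0 // subr_le0 escape_le_state.
(* maxima of subsolutions are subsolutions; the cut-off at F_m bounds f *)
pose f x := if (x < fib m)%N then Num.max (g x) 0 else 0.
have f0 x : 0 <= f x by rewrite /f; case: ifP => // _; rewrite le_max lexx orbT.
have f_ge x : (x <= fib m)%N -> g x <= f x.
  rewrite /f leq_eqVlt => /predU1P[->|->]; first by rewrite ltnn gm.
  by rewrite le_max lexx.
have f_low x : (x <= a)%N -> f x = 0.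
  by move=> /g_low gx; rewrite /f max_r // if_same.
pose B0 := \sum_(i < fib m) f i.
have B00 : 0 <= B0 by exact: sumr_ge0.
have f_bnd x : f x <= B0.
  case: (ltnP x (fib m)) => [xm|mx]; last by rewrite /f ltnNge mx.
  by rewrite /B0 (bigD1 (Ordinal xm)) //= lerDl sumr_ge0.
have f_sub x : x != a -> f x <= 1 + mean p f x.
  move=> xa; have mf : 0 <= mean p f x by exact: mean_ge0.
  have m1 : 0 <= 1 + mean p f x by rewrite addr_ge0.
  rewrite {1}/f; case: ifP => // xm; rewrite ge_max m1 andbT.
  case: (posnP x) => [x0|x0].
    by apply: le_trans m1; rewrite x0; exact: g_low.
  rewrite -[leLHS](subrK 1) -g_mean // addrC lerD2l; apply: (le_mean hp) => y yx.
  by apply: f_ge; lia.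
have surv0 : B0 * survival n (fib n0) @[n --> \oo] --> (0 : R).
  by rewrite -(mulr0 B0); apply: cvgMr; exact: survival_to0.
have [n _ /(_ n (leqnn n)) /= n1] := cvgr_lt _ surv0 1 ltr01.
have fa0 : f a <= 0 by rewrite f_low.
have xa : fib n0 != a by rewrite gtn_eqF.
have := subsolution_le_truncated_time n B00 f_bnd fa0 f_sub xa.
have gf : g (fib n0) <= f (fib n0) by apply: f_ge; apply: fib_homo; exact: ltnW.
have : c - ascent_time p (fib n0) <= g (fib n0).
  rewrite /g lerD2r ler_peMr // /escape height_fib /= lerBrDl.
  exact/ltW.
exists n; lra.
Qed.

End nullity.
End survival.

(** * From the draws to the means *)

Section probability.
Local Open Scope ring_scope.
Variables (R : realType) (p : nat -> R).
Hypothesis hp : forall i, 0 < p i.+1 <= 1.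
Variables (d : measure_display) (T : measurableType d) (P : probability T R).
Variable e : nat -> nat -> {RV P >-> bool}.
Hypothesis he : adding_machine_draws p e.

Definition bit_prob (jb : (nat * nat) * bool) : R :=
  if jb.2 then p jb.1.2.+1 else 1 - p jb.1.2.+1.

(** The event that prescribes the draws listed in [l], each with its value. *)
Definition cylinder (l : seq ((nat * nat) * bool)) : set T :=
  [set w | all (fun jb => e jb.1.1 jb.1.2 w == jb.2) l].

Lemma measurable_draw n i (A : set bool) : measurable (e n i @^-1` A).
Proof. by rewrite -[X in measurable X]setTI; exact: measurable_funPT. Qed.

Lemma draw_prob jb : P (e jb.1.1 jb.1.2 @^-1` [set jb.2]) = (bit_prob jb)%:E.
Proof.
case: jb => -[n i] [] /=; rewrite /bit_prob /=; first exact: he.1.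
have -> : e n i @^-1` [set false] = ~` (e n i @^-1` [set true]).
  by apply/seteqP; split => w /=; case: (e n i w).
rewrite probability_setC; last exact: measurable_draw.
by rewrite he.1.
Qed.

Lemma cylinder_cat l l' : cylinder (l ++ l') = cylinder l `&` cylinder l'.
Proof.
by apply/seteqP; split => w; rewrite /cylinder /= all_cat => /andP.
Qed.

Lemma measurable_cylinder l : measurable (cylinder l).
Proof.
elim: l => [|jb l IH].
  by rewrite (_ : cylinder _ = setT) //; apply/seteqP; split.
rewrite -cat1s cylinder_cat; apply: measurableI => //.
rewrite (_ : cylinder _ = e jb.1.1 jb.1.2 @^-1` [set jb.2]).
  exact: measurable_draw.
by apply/seteqP; split => w /=; rewrite /cylinder /= andbT => /eqP.
Qed.

Lemma cylinder_prob l : uniq (map fst l) ->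
  P (cylinder l) = (\prod_(jb <- l) bit_prob jb)%:E.
Proof.
move=> ul.
have key j b b' : (j, b) \in l -> (j, b') \in l -> b = b'.
  move=> jb jb'; have := ul; elim: (l) jb jb' => //= -[i c] s IH.
  rewrite !inE => h1 h2 /andP[/= ins us].
  case/predU1P: h1 => [[ji bc]|h1]; case/predU1P: h2 => [[ji' bc']|h2].
  - by rewrite bc bc'.
  - by move: ins; rewrite -ji (map_f fst h2).
  - by move: ins; rewrite -ji' (map_f fst h1).
  - exact: IH.
pose A (j : nat * nat) : set bool := [set b | (j, b) \in l].
pose J := [fset j in map fst l]%fset.
have -> : cylinder l = \bigcap_(j in [set` J]) (e j.1 j.2 @^-1` A j).
  apply/seteqP; split => w /=.
    move=> /allP h j /=; rewrite !inE => /mapP[[i b] ib ->] /=.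
    by have /eqP := h _ ib => /= ->.
  move=> h; apply/allP => -[i b] ib /=.
  have iJ : i \in J by rewrite !inE (map_f fst ib).
  by apply/eqP/(key i) => //; exact: (h i iJ).
rewrite he.2; last by [].
rewrite (perm_big (map fst l)) /=; last first.
  apply: uniq_perm => //; first exact: fset_uniq.
  by move=> j; rewrite !inE.
rewrite big_map (big_morph EFin EFinM erefl) /=.
apply: eq_big_seq => -[j b] jb.
rewrite -(draw_prob (j, b)) /=; congr (P _).
have -> : A j = [set b]; last by [].
by apply/seteqP; split => c /=; [move=> jc; exact: key jc jb|move=> ->].
Qed.

(** [avoid a n x m w]: the chain that is at [x] at time [m] is different from
    [a] at the [n] following times. *)
Fixpoint avoid a n x m w : bool :=
  if n is n'.+1 then
    let y := fib_step (fun i => e m i w) x in (y != a) && avoid a n' y m.+1 w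
  else true.

(** The draws at time [m] that decide that the outcome has index [r]. *)
Definition outcome_bits k m r : seq ((nat * nat) * bool) :=
  [seq ((m, i), true) | i <- iota 0 r] ++
  (if (r <= k)%N then [:: ((m, r), false)] else [::]).

Lemma outcome_bits_prob k m r :
  \prod_(jb <- outcome_bits k m r) bit_prob jb = outcome_prob p k r.
Proof.
rewrite /outcome_bits big_cat /= big_map /outcome_prob /=.
have -> : \prod_(i <- iota 0 r) bit_prob ((m, i), true) = carry_prob p r.
  by rewrite /carry_prob -(big_mkord xpredT (fun i => p i.+1)) /index_iota subn0.
case: ifP => _; last by rewrite big_nil mulr1.
by rewrite big_seq1 /bit_prob /= mulrBr mulr1 carry_probS.
Qed.

Lemma outcome_bits_keys k m r :
  uniq (map fst (outcome_bits k m r)) /\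
  {in map fst (outcome_bits k m r), forall j, j.1 = m}.
Proof.
have -> : map fst (outcome_bits k m r) =
    [seq (m, i) | i <- iota 0 (if (r <= k)%N then r.+1 else r)].
  rewrite /outcome_bits map_cat -map_comp; case: ifP => _; last by rewrite cats0.
  by rewrite -(addn1 r) iotaD map_cat.
split; last by move=> j /mapP[i _ ->].
by rewrite map_inj_uniq ?iota_uniq // => i j [].
Qed.

Lemma outcome_bitsP k m r w : (r <= k.+1)%N ->
  cylinder (outcome_bits k m r) w <->
  (forall i, (i < r)%N -> e m i w) /\ ((r <= k)%N -> ~~ e m r w).
Proof.
move=> rk; rewrite /cylinder /= all_cat; split.
  move=> /andP[/allP h1 h2]; split=> [i ir|rk'].
    have := h1 ((m, i), true); rewrite /= eqb_id; apply.
    by apply/mapP; exists i => //; rewrite mem_iota.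
  by move: h2; rewrite rk' /= andbT => /eqP ->.
move=> [h1 h2]; apply/andP; split.
  apply/allP => _ /mapP[i + ->] /=; rewrite mem_iota add0n => /andP[_ ir].
  by rewrite h1.
by case: ifP => // rk'; rewrite /= andbT (negbTE (h2 rk')).
Qed.

Lemma outcome_bits_exists k m w :
  exists2 r, (r <= k.+1)%N & cylinder (outcome_bits k m r) w.
Proof.
pose r := find (fun i => ~~ e m i w) (iota 0 k.+1).
have rk : (r <= k.+1)%N by rewrite /r -[X in (_ <= X)%N](size_iota 0) find_size.
exists r => //; apply/outcome_bitsP => //; split=> [i ir|rk'].
  have := before_find 0 ir; rewrite nth_iota ?add0n; last lia.
  by move=> /negbT; rewrite negbK.
have := @nth_find _ 0 (fun i => ~~ e m i w) (iota 0 k.+1).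
rewrite -/r nth_iota ?add0n; last lia.
by apply; rewrite has_find size_iota ltnS.
Qed.

Lemma outcome_bits_inj k m r s w : (r <= k.+1)%N -> (s <= k.+1)%N ->
  cylinder (outcome_bits k m r) w -> cylinder (outcome_bits k m s) w -> r = s.
Proof.
move=> rk sk /(outcome_bitsP _ _ rk)[r1 r2] /(outcome_bitsP _ _ sk)[s1 s2].
case: (ltngtP r s) => // [rs|sr].
  have /r2 : (r <= k)%N by lia.
  by rewrite s1.
have /s2 : (s <= k)%N by lia.
by rewrite r1.
Qed.

(** The Markov property.  The cylinder over the past ([l] involves times before
    [m] only) is what makes the induction on [n] go through: the draws deciding
    the next outcome join the past. *)
Lemma avoid_prob a n x m l : uniq (map fst l) ->
  {in map fst l, forall j, j.1 < m}%N ->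
  measurable (cylinder l `&` [set w | avoid a n x m w]) /\
  P (cylinder l `&` [set w | avoid a n x m w]) =
    ((\prod_(jb <- l) bit_prob jb) * survival p a n x)%:E.
Proof.
elim: n x m l => [|n IH] x m l ul lm.
  rewrite (_ : [set w | _] = setT) ?setIT ?mulr1; last by apply/seteqP; split.
  by split; [exact: measurable_cylinder|exact: cylinder_prob].
pose k := blocks x.
pose F (r : 'I_k.+2) : set T := cylinder (outcome_bits k m r ++ l) `&`
  (if outcome x r == a then set0 else [set w | avoid a n (outcome x r) m.+1 w]).
have stepE (r : 'I_k.+2) w : cylinder (outcome_bits k m r) w ->
    fib_step (fun i => e m i w) x = outcome x r.
  have rk : (r <= k.+1)%N by rewrite -ltnS.
  by move=> /(outcome_bitsP _ _ rk)[h1 h2]; exact: fib_step_outcome.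
have -> : cylinder l `&` [set w | avoid a n.+1 x m w] =
    \big[setU/set0]_(r < k.+2) F r.
  rewrite -bigcup_mkord_ord; apply/seteqP; split => w /=.
    move=> [lw /andP[xa aw]].
    have [r rk rw] := outcome_bits_exists k m w.
    have rk' : (r < k.+2)%N by [].
    exists r => //=; have := stepE (Ordinal rk') w rw => /= sE.
    rewrite /F cylinder_cat (_ : inord r = Ordinal rk'); last first.
      by apply/val_inj; rewrite /= inordK.
    by split; [split|rewrite /= -sE (negbTE xa) /=].
  move=> [r /= rk]; rewrite /F cylinder_cat inordK // => -[[rw lw]].
  have := stepE (Ordinal rk) w rw => /= ->.
  by case: ifP.
have FP r : measurable (F r) /\ P (F r) =
    ((\prod_(jb <- l) bit_prob jb) *
     (outcome_prob p k r * killed p a n (outcome x r)))%:E.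
  have [ub bm] := outcome_bits_keys k m r.
  rewrite /F /killed; case: ifP => _.
    by rewrite setI0 measure0 !mulr0.
  have [||mF ->] := IH (outcome x r) m.+1 (outcome_bits k m r ++ l).
  - rewrite map_cat cat_uniq ub ul andbT /=; apply/hasPn => j jl.
    by apply/negP => /bm jm; have := lm _ jl; rewrite jm ltnn.
  - move=> j; rewrite map_cat mem_cat => /orP[/bm -> //|/lm]; lia.
  - by split=> //; rewrite big_cat /= outcome_bits_prob; congr _%:E; ring.
split; first by apply: bigsetU_measurable => r _; case: (FP r).
rewrite measure_bigsetU_ord => [|r|]; last 2 first.
- by case: (FP r).
- move=> r s _ _ [w [Fr Fs]]; move: Fr Fs; rewrite /F 2!(cylinder_cat _ l).
  move=> -[[rw _] _] [[sw _] _]; apply/val_inj.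
  by apply: (outcome_bits_inj _ _ rw sw); rewrite -ltnS.
rewrite survivalS /mean mulr_sumr -sumEFin; apply: eq_bigr => r _.
by case: (FP r).
Qed.

Lemma measurable_avoid a n : measurable [set w | avoid a n a 0 w].
Proof.
have [//||+ _] := @avoid_prob a n a 0 [::]; first by [].
by rewrite (_ : cylinder _ = setT) ?setTI //; apply/seteqP; split.
Qed.

Lemma avoid_survival a n : P [set w | avoid a n a 0 w] = (survival p a n a)%:E.
Proof.
have [//||_] := @avoid_prob a n a 0 [::]; first by [].
rewrite (_ : cylinder _ = setT) ?setTI ?big_nil ?mul1r //.
by apply/seteqP; split.
Qed.

Lemma avoid_chain a n m w : avoid a n (fib_chain e a m w) m w <->
  forall j, (m < j <= m + n)%N -> fib_chain e a j w <> a.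
Proof.
elim: n m => [|n IH] m /=; first by split=> // _ j; lia.
split=> [/andP[ma aw] j|h].
  rewrite leq_eqVlt => /andP[/predU1P[<- _|mj jn]]; first exact/eqP.
  by move: aw; rewrite -[fib_step _ _]/(fib_chain e a m.+1 w) IH; apply; lia.
apply/andP; split; first by apply/eqP/(h m.+1); lia.
rewrite -[fib_step _ _]/(fib_chain e a m.+1 w); apply/IH => j jn; apply: h; lia.
Qed.

Lemma avoidP a n w : avoid a n a 0 w <->
  forall j, (0 < j <= n)%N -> fib_chain e a j w <> a.
Proof. exact: (avoid_chain a n 0 w). Qed.

Lemma return_time_fin a w :
  (return_time (R := R) (fib_chain e a) a w < +oo)%E <-> exists n, ~~ avoid a n a 0 w.
Proof.
split=> [/ereal_inf_lt[_ [j /= [j0 ja] _] _]|[n]].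
  by exists j; apply/negP => /avoidP /(_ j); rewrite j0 leqnn => /(_ isT).
move=> /negP h; apply: contrapT => noret; apply: h; apply/avoidP => j /andP[j0 _] ja.
apply: noret; apply: (@le_lt_trans _ _ (j%:R)%:E); last exact: ltry.
by apply: ereal_inf_lbound; exists j.
Qed.

(** A return time is at least the number of [i < n] before it. *)
Lemma sum_avoid_le_return_time a n w :
  ((\sum_(i < n) (avoid a i a 0 w)%:R)%:E <= return_time (fib_chain e a) a w :> \bar R)%E.
Proof.
apply: le_ereal_inf_tmp => _ [N /= [N0 NA] <-]; rewrite lee_fin.
have avN i : (N <= i)%N -> avoid a i a 0 w = false.
  by move=> Ni; apply/negP => /avoidP /(_ N); rewrite N0 Ni => /(_ isT).
rewrite -natr_sum ler_nat.
suff : (\sum_(i < n) avoid a i a 0 w <= minn n N)%N.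
  by move=> /leq_trans; apply; exact: geq_minr.
elim: n => [|n IH]; first by rewrite big_ord0.
rewrite big_ord_recr /=; move: IH; set s := (\sum_(i < n) _)%N => IH.
case: (leqP N n) => [/avN ->|nN]; first lia.
by have := leq_b1 (avoid a n a 0 w); lia.
Qed.

(** The mean of the previous inequality.  The integral of a nonnegative function
    is a supremum over the simple functions below it, so comparing the integrands
    suffices. *)
Lemma integral_return_time_ge a n :
  ((truncated_time p a n a)%:E <= \int[P]_w return_time (fib_chain e a) a w)%E.
Proof.
have -> : ((truncated_time p a n a)%:E =
    \int[P]_w (\sum_(i < n) (\1_[set w | avoid a i a 0 w] w)%:E))%E.
  rewrite ge0_integral_sum //; last first.
    move=> i; idtac. apply/measurable_EFinP/measurable_indic; exact: measurable_avoid.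
  rewrite -sumEFin; apply: eq_bigr => i _.
  rewrite (integral_indic P measurableT (measurable_avoid a i)) setIT.
  exact/esym/avoid_survival.
rewrite !ge0_integralTE.
- apply: le_ereal_sup => _ [h hle <-]; exists h => // w.
  apply: le_trans (hle w) _; apply: le_trans (sum_avoid_le_return_time a n w).
  rewrite -sumEFin; apply: lee_sum => i _; rewrite lee_fin indicE.
  by rewrite mem_setE.
- move=> w; apply: le_ereal_inf_tmp => _ [N _ <-]; by rewrite lee_fin.
- by move=> w; apply: sume_ge0 => i _; rewrite lee_fin.
Qed.

End probability.

Local Open Scope ring_scope.

(** All [pass_prob] are at most 1, and each [p i] occurs among them. *)
Lemma reach_prob_small (R : realType) (p : nat -> R) :
  (forall i, 0 < p i.+1 <= 1) ->
  (fun n => \prod_(1 <= i < n.+1) p i) @ \oo --> (0 : R) ->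
  forall a eps, 0 < eps -> exists2 n, (a < n)%N & reach_prob p n < eps.
Proof.
move=> hp hprod a eps eps0.
have reach_le n : reach_prob p n.*2 <= \prod_(1 <= i < n.+2) p i.
  rewrite big_add1 /= big_mkord.
  elim: n => [|n IH]; first by rewrite /reach_prob !big_ord1.
  rewrite doubleS !reach_probS big_ord_recr /= mulrAC.
  have -> : pass_prob p n.*2.+2 = p n.+2 by rewrite /pass_prob; congr p; lia.
  have /andP[q0 q1] : 0 < pass_prob p n.*2.+1 <= 1 by exact: hp.
  have /andP[r0 r1] := hp n.+1.
  apply: le_trans (_ : _ <= reach_prob p n.*2 * p n.+2) _.
    by rewrite ler_piMr // mulr_ge0 ?ltW ?reach_prob_gt0.
  by rewrite ler_wpM2r // ltW.
have [n _ hn] := cvgr_lt _ hprod _ eps0.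
exists (n + a).+1.*2; first lia.
apply: le_lt_trans (reach_le _) _; apply: hn => /=; lia.
Qed.

Lemma partial_sum_unbounded (R : realType) (p : nat -> R) :
  (forall i, 0 < p i.+1 <= 1) ->
  (\sum_(1 <= i <oo) (p i)%:E = +oo)%E ->
  forall M, exists n, M <= \sum_(i < n.+1) p i.+1.
Proof.
move=> hp hsum M; apply: contrapT => noM.
have p_ge0 i : 0 <= p i.+1 by case/andP: (hp i) => /ltW.
have : (\sum_(1 <= i <oo) (p i)%:E <= M%:E)%E.
  apply: lime_le.
    by apply: is_cvg_nneseries_cond => -[|i] // _ _; rewrite lee_fin.
  apply: nearW => n; rewrite sumEFin lee_fin leNgt; apply/negP => h.
  apply: noM; exists n; apply: ltW; apply: lt_le_trans h _.
  case: n => [|n]; first by rewrite big_geq // big_ord1.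
  rewrite big_add1 /= big_mkord [leRHS]big_ord_recr /=.
  rewrite [X in _ <= X + _]big_ord_recr /= -addrA lerDl.
  exact: addr_ge0.
by rewrite hsum leye_eq.
Qed.

(** * Null recurrence *)

Theorem theorem2p6 (R : realType) (p : nat -> R)
    (hp : forall i : nat, (1 <= i)%N -> 0 < p i <= 1)
    (hprod : (fun n : nat => \prod_(1 <= i < n.+1) p i) @ \oo --> (0 : R))
    (hsum : (\sum_(1 <= i <oo) (p i)%:E = +oo)%E)
    (d : measure_display) (T : measurableType d) (P : probability T R)
    (e : nat -> nat -> {RV P >-> bool})
    (he : adding_machine_draws p e) :
  null_recurrent P (fib_chain e).
Proof.
have hp' i : (0 < p i.+1 <= 1)%R by exact: hp.
have reach0 a := reach_prob_small hp' hprod a.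
have p_sum := partial_sum_unbounded hp' hsum.
move=> a; split.
- have mA n := measurable_avoid he a n.
  have mI : measurable (\bigcap_n [set w | avoid e a n a 0 w]).
    by apply: bigcapT_measurable.
  have -> : [set w | (return_time (R := R) (fib_chain e a) a w < +oo)%E] =
      ~` \bigcap_n [set w | avoid e a n a 0 w].
    rewrite setC_bigcap; apply/seteqP; split => w /=.
      by move=> /return_time_fin[n hn]; exists n => //=; exact/negP.
    by move=> [n _ /negP hn]; apply/return_time_fin; exists n.
  rewrite probability_setC //.
  suff -> : P (\bigcap_n [set w | avoid e a n a 0 w]) = 0%E by rewrite sube0.
  apply/eqP; rewrite eq_le measure_ge0 andbT.
  apply/lee_addgt0Pr => eps eps0; rewrite add0e.
  have [n _ /(_ n (leqnn n)) /= hn] :=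
    cvgr_lt _ (survival_to0 hp' (reach0 a) a) _ eps0.
  apply: (@le_trans _ _ (P [set w | avoid e a n a 0 w])).
    by apply: le_measure; rewrite ?inE // => w h; exact: h.
  by rewrite (avoid_survival he) lee_fin ltW.
- apply: eq_infty => M.
  have [n Mn] := truncated_time_unbounded hp' (reach0 a) p_sum M.
  apply: (@le_trans _ _ (truncated_time p a n a)%:E); first by rewrite lee_fin.
  exact: (integral_return_time_ge he a n).
Qed.
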